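(* Let $a>b>c>0$ and consider the ellipsoid $\mathcal{E}:\ \frac{x^2}{a^2}+\frac{y^2}{b^2}+\frac{z^2}{c^2}=1$. Consider the following curves in $\mathbb{R}^3$ ($t\in[0,2\pi)$): Ellipse 1: $(a\cos t,\, b\sin t,\, 0)$; Ellipse 2: $(a\cos t,\,0,\,c\sin t)$; Ellipse 3: $(0,\,b\cos t,\,c\sin t)$; Astroida 4: $\left(\frac{a^2-b^2}{a}\cos^3 t,\,\frac{a^2-b^2}{b}\sin^3 t,\,0\right)$; Astroida 5: $\left(\frac{a^2-c^2}{a}\cos^3 t,\,0,\,\frac{a^2-c^2}{c}\sin^3 t\right)$; Astroida 6: $\left(0,\,\frac{b^2-c^2}{b}\cos^3 t,\,\frac{b^2-c^2}{c}\sin^3 t\right)$; Ellipse 7: $\left(\frac{a^2-c^2}{a}\cos t,\,\frac{b^2-c^2}{b}\sin t,\,0\right)$; Ellipse 8: $\left(\frac{a^2-b^2}{a}\cos t,\,0,\,\frac{b^2-c^2}{c}\sin t\right)$; Ellipse 9: $\left(0,\,\frac{a^2-b^2}{b}\cos t,\,\frac{a^2-c^2}{c}\sin t\right)$. In what follows, ''$(\pm u,\pm v)$-type points'' means all four sign combinations. Then: (1) If $a^2\ge 2b^2$, Ellipse 1 and Astroida 4 intersect at the points $(\pm x_0,\pm y_0,0)$, where $x_0=\sqrt{\frac{a^4(a^2-2b^2)^3}{(a^2-b^2)(a^2+b^2)^3}}$, $y_0=\sqrt{\frac{b^4(2a^2-b^2)^3}{(a^2-b^2)(a^2+b^2)^3}}$.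 (2) If $a^2\ge 2c^2$, Ellipse 2 and Astroida 5 intersect at $(\pm x_1,0,\pm z_1)$, where $x_1=\sqrt{\frac{a^4(a^2-2c^2)^3}{(a^2-c^2)(a^2+c^2)^3}}$, $z_1=\sqrt{\frac{c^4(2a^2-c^2)^3}{(a^2-c^2)(a^2+c^2)^3}}$. (3) If $b^2\ge 2c^2$, Ellipse 3 and Astroida 6 intersect at $(0,\pm y_2,\pm z_2)$, where $y_2=\sqrt{\frac{b^4(b^2-2c^2)^3}{(b^2-c^2)(b^2+c^2)^3}}$, $z_2=\sqrt{\frac{c^4(2b^2-c^2)^3}{(b^2-c^2)(b^2+c^2)^3}}$. (4) Ellipse 1 and Ellipse 7 have no real intersection points; the (complex) common points of the conics $\frac{x^2}{a^2}+\frac{y^2}{b^2}=1$ and $\frac{a^2x^2}{(a^2-c^2)^2}+\frac{b^2y^2}{(b^2-c^2)^2}=1$ in the plane $z=0$ are $(\pm x^*,\pm y^*,0)$, where $(x^* )^2=\frac{a^2(a^2-c^2)^2(2b^2-c^2)}{(a^2-b^2)(2a^2b^2-a^2c^2-b^2c^2)}$ and $(y^* )^2=\frac{b^2(b^2-c^2)^2(2a^2-c^2)}{(b^2-a^2)(2a^2b^2-b^2c^2-a^2c^2)}$ (the latter being negative). (5) If $b^2\ge 2c^2$, Ellipse 2 and Ellipse 8 intersect at $(\pm x_3,0,\pm z_3)$, where $x_3=\sqrt{\frac{a^2(a^2-b^2)^2(2c^2-b^2)}{(a^2-c^2)(2a^2c^2-a^2b^2-b^2c^2)}}$, $z_3=\sqrt{\frac{c^2(c^2-b^2)^2(2a^2-b^2)}{(c^2-a^2)(2a^2c^2-a^2b^2-b^2c^2)}}$;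 moreover $x_1\ge x_3$ and $z_1\le z_3$, with equality when $\frac1{a^2}+\frac1{c^2}=\frac3{b^2}$. (6) If $2b^2\ge a^2\ge 2c^2$, Ellipse 3 and Ellipse 9 intersect at $(0,\pm y_4,\pm z_4)$, where $y_4=\sqrt{\frac{b^2(b^2-a^2)^2(2c^2-a^2)}{(b^2-c^2)(2b^2c^2-a^2b^2-a^2c^2)}}$, $z_4=\sqrt{\frac{c^2(c^2-a^2)^2(2b^2-a^2)}{(c^2-b^2)(2b^2c^2-a^2b^2-a^2c^2)}}$. In particular (when also $b^2\ge 2c^2$, so that $y_2,z_2$ are defined), $y_2\ge y_4$ and $z_2\le z_4$ if and only if $2b^4+2c^4-a^2b^2-a^2c^2-2b^2c^2\ge 0$. (7) If $a^2+c^2\ge 2b^2$, Astroida 4 and Ellipse 7 intersect at $(\pm x_5,\pm y_5,0)$, where $x_5=\sqrt{\frac{(a^2-c^2)^3(2b^2-a^2-c^2)^3}{a^2(b^2-a^2)(a^2+b^2-2c^2)^3}}$, $y_5=\sqrt{\frac{(b^2-c^2)^3(2a^2-b^2-c^2)^3}{b^2(a^2-b^2)(a^2+b^2-2c^2)^3}}$. (8) Astroida 5 and Ellipse 8 are tangent to each other at the points $(\pm x_6,0,\pm z_6)$, where $x_6=\sqrt{\frac{(a^2-b^2)^3}{a^2(a^2-c^2)}}$, $z_6=\sqrt{\frac{(b^2-c^2)^3}{c^2(a^2-c^2)}}$. These points divide Astroida 5 and Ellipse 8 into parts which belong to different sheets of the caustic of $\mathcal{E}$. These points lie on, inside, or outside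 $\mathcal{E}$ according as $\frac1{a^2}+\frac1{c^2}=\frac3{b^2}$, $<\frac3{b^2}$, or $>\frac3{b^2}$, respectively. (9) If $a^2+c^2\le 2b^2$, Astroida 6 and Ellipse 9 intersect at $(0,\pm y_7,\pm z_7)$, where $y_7=\sqrt{\frac{(b^2-a^2)^3(2c^2-b^2-a^2)^3}{b^2(c^2-b^2)(b^2+c^2-2a^2)^3}}$, $z_7=\sqrt{\frac{(c^2-a^2)^3(2b^2-c^2-a^2)^3}{c^2(b^2-c^2)(b^2+c^2-2a^2)^3}}$. These points lie on, inside, or outside $\mathcal{E}$ according as $2b^4+2c^4-a^2b^2-a^2c^2-2b^2c^2=0$, $<0$, or $>0$, respectively.
   Context: The caustic (focal surface, centro-surface) of $\mathcal{E}$ consists of two sheets: for each point $P$ of $\mathcal{E}$ with outer normal $\mathbf N=(x/a^2,y/b^2,z/c^2)$ and principal curvatures $k_1\le k_2$ (principal radii $R_i=1/k_i$), the centers of principal curvature are $C_i=P-R_i\,\mathbf N/|\mathbf N|$; the sheet formed by the points $C_1$ (greater radius) and the sheet formed by the points $C_2$ (smaller radius) are the two caustics. Equivalently, the caustic is the set of points $(X,Y,Z)$ for which there is $t$ with $\frac{a^2X^2}{(a^2+t)^2}+\frac{b^2Y^2}{(b^2+t)^2}+\frac{c^2Z^2}{(c^2+t)^2}=1$ and $\frac{a^2X^2}{(a^2+t)^3}+\frac{b^2Y^2}{(b^2+t)^3}+\frac{c^2Z^2}{(c^2+t)^3}=0$. The curves listed are the intersections of $\mathcal{E}$ and of its caustics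 with the coordinate planes. *)

(* Defs.v *)
From Stdlib Require Import Reals.
From Coquelicot Require Import Coquelicot.
Open Scope R_scope.

Definition pt := (R * R * R)%type.
Definition px (p : pt) : R := fst (fst p).
Definition py (p : pt) : R := snd (fst p).
Definition pz (p : pt) : R := snd p.

Definition ellipse1 (a b c t : R) : pt := (a * cos t, b * sin t, 0).
Definition ellipse2 (a b c t : R) : pt := (a * cos t, 0, c * sin t).
Definition ellipse3 (a b c t : R) : pt := (0, b * cos t, c * sin t).
Definition astroida4 (a b c t : R) : pt :=
  ((a^2 - b^2) / a * (cos t)^3, (a^2 - b^2) / b * (sin t)^3, 0).
Definition astroida5 (a b c t : R) : pt :=
  ((a^2 - c^2) / a * (cos t)^3, 0, (a^2 - c^2) / c * (sin t)^3).
Definition astroida6 (a b c t : R) : pt :=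
  (0, (b^2 - c^2) / b * (cos t)^3, (b^2 - c^2) / c * (sin t)^3).
Definition ellipse7 (a b c t : R) : pt :=
  ((a^2 - c^2) / a * cos t, (b^2 - c^2) / b * sin t, 0).
Definition ellipse8 (a b c t : R) : pt :=
  ((a^2 - b^2) / a * cos t, 0, (b^2 - c^2) / c * sin t).
Definition ellipse9 (a b c t : R) : pt :=
  (0, (a^2 - b^2) / b * cos t, (a^2 - c^2) / c * sin t).

Definition on_curve (f : R -> pt) (p : pt) : Prop :=
  exists t, 0 <= t < 2 * PI /\ f t = p.

Definition intersect_at (f g : R -> pt) (S : pt -> Prop) : Prop :=
  forall p, (on_curve f p /\ on_curve g p) <-> S p.

Definition pm (u x : R) : Prop := x = u \/ x = - u.
Definition pts_xy (u v : R) (p : pt) : Prop :=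
  pm u (px p) /\ pm v (py p) /\ pz p = 0.
Definition pts_xz (u v : R) (p : pt) : Prop :=
  pm u (px p) /\ py p = 0 /\ pm v (pz p).
Definition pts_yz (u v : R) (p : pt) : Prop :=
  px p = 0 /\ pm u (py p) /\ pm v (pz p).

Definition curve_deriv (f : R -> pt) (t : R) (d : pt) : Prop :=
  is_derive (fun s => px (f s)) t (px d) /\
  is_derive (fun s => py (f s)) t (py d) /\
  is_derive (fun s => pz (f s)) t (pz d).

Definition cross (u v : pt) : pt :=
  (py u * pz v - pz u * py v, pz u * px v - px u * pz v,
   px u * py v - py u * px v).

Definition zero_pt : pt := (0, 0, 0).

Definition tangent_at (f g : R -> pt) (p : pt) : Prop :=
  exists t s df dg,
    0 <= t < 2 * PI /\ 0 <= s < 2 * PI /\ f t = p /\ g s = p /\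
    curve_deriv f t df /\ curve_deriv g s dg /\
    df <> zero_pt /\ dg <> zero_pt /\ cross df dg = zero_pt.

Definition tangent_curves_at (f g : R -> pt) (S : pt -> Prop) : Prop :=
  intersect_at f g S /\ forall p, S p -> tangent_at f g p.

Definition ellF (a b c : R) (p : pt) : R :=
  (px p)^2 / a^2 + (py p)^2 / b^2 + (pz p)^2 / c^2.
Definition on_E (a b c : R) (p : pt) : Prop := ellF a b c p = 1.
Definition inside_E (a b c : R) (p : pt) : Prop := ellF a b c p < 1.
Definition outside_E (a b c : R) (p : pt) : Prop := ellF a b c p > 1.

Definition dot (u v : pt) : R := px u * px v + py u * py v + pz u * pz v.
Definition vnorm (u : pt) : R := sqrt (dot u u).
Definition vadd (u v : pt) : pt := (px u + px v, py u + py v, pz u + pz v).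
Definition vscale (k : R) (u : pt) : pt := (k * px u, k * py u, k * pz u).

Definition normalN (a b c : R) (p : pt) : pt :=
  (px p / a^2, py p / b^2, pz p / c^2).
(* (half) Hessian of the defining function: v |-> (vx/a^2, vy/b^2, vz/c^2) *)
Definition hessD (a b c : R) (v : pt) : pt :=
  (px v / a^2, py v / b^2, pz v / c^2).

(* k is a principal curvature of E at p: an eigenvalue of the shape operator
   v |-> (projection onto T_pE of D v) / |N| restricted to the tangent plane
   T_pE = N^perp (Weingarten map of the outer unit normal N/|N|). *)
Definition principal_curvature (a b c : R) (p : pt) (k : R) : Prop :=
  on_E a b c p /\
  exists v : pt, v <> zero_pt /\ dot v (normalN a b c p) = 0 /\
    exists mu : R,
      hessD a b c v = vadd (vscale (k * vnorm (normalN a b c p)) v)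
                           (vscale mu (normalN a b c p)).

Definition curv_center (a b c : R) (p : pt) (k : R) : pt :=
  vadd p (vscale (- (1 / k) / vnorm (normalN a b c p)) (normalN a b c p)).

Definition caustic_sheet1 (a b c : R) (q : pt) : Prop :=
  exists p k, principal_curvature a b c p k /\
    (forall k', principal_curvature a b c p k' -> k <= k') /\
    q = curv_center a b c p k.
Definition caustic_sheet2 (a b c : R) (q : pt) : Prop :=
  exists p k, principal_curvature a b c p k /\
    (forall k', principal_curvature a b c p k' -> k' <= k) /\
    q = curv_center a b c p k.

Definition x0 a b := sqrt (a^4 * (a^2 - 2*b^2)^3 / ((a^2 - b^2) * (a^2 + b^2)^3)).
Definition y0 a b := sqrt (b^4 * (2*a^2 - b^2)^3 / ((a^2 - b^2) * (a^2 + b^2)^3)).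
Definition x1 a c := sqrt (a^4 * (a^2 - 2*c^2)^3 / ((a^2 - c^2) * (a^2 + c^2)^3)).
Definition z1 a c := sqrt (c^4 * (2*a^2 - c^2)^3 / ((a^2 - c^2) * (a^2 + c^2)^3)).
Definition y2 b c := sqrt (b^4 * (b^2 - 2*c^2)^3 / ((b^2 - c^2) * (b^2 + c^2)^3)).
Definition z2 b c := sqrt (c^4 * (2*b^2 - c^2)^3 / ((b^2 - c^2) * (b^2 + c^2)^3)).
(* squares of the complex coordinates in (4) *)
Definition xstar2 a b c :=
  a^2 * (a^2 - c^2)^2 * (2*b^2 - c^2) / ((a^2 - b^2) * (2*a^2*b^2 - a^2*c^2 - b^2*c^2)).
Definition ystar2 a b c :=
  b^2 * (b^2 - c^2)^2 * (2*a^2 - c^2) / ((b^2 - a^2) * (2*a^2*b^2 - b^2*c^2 - a^2*c^2)).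
Definition x3 a b c := sqrt (a^2 * (a^2 - b^2)^2 * (2*c^2 - b^2)
                             / ((a^2 - c^2) * (2*a^2*c^2 - a^2*b^2 - b^2*c^2))).
Definition z3 a b c := sqrt (c^2 * (c^2 - b^2)^2 * (2*a^2 - b^2)
                             / ((c^2 - a^2) * (2*a^2*c^2 - a^2*b^2 - b^2*c^2))).
Definition y4 a b c := sqrt (b^2 * (b^2 - a^2)^2 * (2*c^2 - a^2)
                             / ((b^2 - c^2) * (2*b^2*c^2 - a^2*b^2 - a^2*c^2))).
Definition z4 a b c := sqrt (c^2 * (c^2 - a^2)^2 * (2*b^2 - a^2)
                             / ((c^2 - b^2) * (2*b^2*c^2 - a^2*b^2 - a^2*c^2))).
Definition x5 a b c := sqrt ((a^2 - c^2)^3 * (2*b^2 - a^2 - c^2)^3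
                             / (a^2 * (b^2 - a^2) * (a^2 + b^2 - 2*c^2)^3)).
Definition y5 a b c := sqrt ((b^2 - c^2)^3 * (2*a^2 - b^2 - c^2)^3
                             / (b^2 * (a^2 - b^2) * (a^2 + b^2 - 2*c^2)^3)).
Definition x6 a b c := sqrt ((a^2 - b^2)^3 / (a^2 * (a^2 - c^2))).
Definition z6 a b c := sqrt ((b^2 - c^2)^3 / (c^2 * (a^2 - c^2))).
Definition y7 a b c := sqrt ((b^2 - a^2)^3 * (2*c^2 - b^2 - a^2)^3
                             / (b^2 * (c^2 - b^2) * (b^2 + c^2 - 2*a^2)^3)).
Definition z7 a b c := sqrt ((c^2 - a^2)^3 * (2*b^2 - c^2 - a^2)^3
                             / (c^2 * (b^2 - c^2) * (b^2 + c^2 - 2*a^2)^3)).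

Definition Q6 a b c := 2*b^4 + 2*c^4 - a^2*b^2 - a^2*c^2 - 2*b^2*c^2.

(* Main.v *)
(* All curves of the statement lie in coordinate planes, where each is an ellipse
   (A cos t, B sin t) or an astroid (P cos^3 t, Q sin^3 t).  Two such ellipses meet where
   (x^2, y^2) solves a 2x2 linear system; for the semi-axes p, q and the ellipse with semi-axes
   (p^2 - r^2)/p, (q^2 - r^2)/q its solution is (xstar2 p q r, ystar2 p q r), and this one
   computation gives (4), (5) and (6).  An astroid point with cos^2 t = u lies on an ellipse
   iff u solves the cubic al u^3 + be (1 - u)^3 = 1 on [0, 1]; the root is unique when one of
   al, be is < 1 and the other >= 1, which gives (1), (2), (3), (7) and (9), whereas in (8) it
   is a double root, which is also why the two curves are tangent there.
   In the section y = 0 of the ellipsoid both principal curvatures are explicit: the centers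
   of one trace Astroid 5 and those of the other trace Ellipse 8, and the curvatures cross
   exactly where cos^2 t = (a^2 - b^2)/(a^2 - c^2), i.e. at the tangency points, which
   therefore separate the two sheets of the caustic.  The remaining comparisons come down to
   the sign of explicit rational identities. *)

Require Import Defs.
From Stdlib Require Import Reals Lra.
From Coquelicot Require Import Coquelicot.
Open Scope R_scope.

Ltac nonzero := repeat match goal with
  | |- _ /\ _ => split
  | |- _ * _ <> 0 => apply Rmult_integral_contrapositive_currified
  | |- _ ^ _ <> 0 => apply pow_nonzero
  | |- _ / _ <> 0 => unfold Rdiv; apply Rmult_integral_contrapositive_currified
  | |- / _ <> 0 => apply Rinv_neq_0_compat
  | |- _ <> 0 => assumption
  | |- _ <> 0 => let H := fresh in intro H; nra
  end.

Ltac positivity := repeat match goal with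
  | |- _ > _ => unfold Rgt
  | |- 0 < _ => assumption
  | |- 0 < _ * _ => apply Rmult_lt_0_compat
  | |- 0 < / _ => apply Rinv_0_lt_compat
  | |- 0 < _ / _ => apply Rdiv_lt_0_compat
  | |- 0 < _ ^ _ => apply pow_lt
  | |- 0 <= _ * _ => apply Rmult_le_pos
  | |- 0 <= / _ => apply Rlt_le, Rinv_0_lt_compat
  | |- 0 <= _ / _ => apply Rmult_le_pos
  | |- 0 <= _ ^ 2 => apply pow2_ge_0
  | |- 0 <= _ ^ _ => apply pow_le
  | |- 0 < _ + _ => apply Rplus_lt_le_0_compat
  | |- 0 <= _ + _ => apply Rplus_le_le_0_compat
  end.

Lemma unit_circle_angle X Y : X^2 + Y^2 = 1 ->
  exists t, 0 <= t < 2*PI /\ cos t = X /\ sin t = Y.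
Proof.
  intros H.
  assert (HX : -1 <= X <= 1) by nra.
  pose proof (acos_bound X). pose proof PI_RGT_0.
  destruct (Rle_lt_dec 0 Y) as [HY|HY].
  - exists (acos X). split; [lra|]. split; [apply cos_acos; auto|].
    rewrite sin_acos by auto.
    replace (1 - X²) with (Y^2) by (unfold Rsqr; lra).
    apply sqrt_pow2; auto.
  - exists (2*PI - acos X).
    assert (acos X <> 0).
    { intros E. pose proof (cos_acos X HX) as Hc. rewrite E, cos_0 in Hc. subst X. nra. }
    split; [split; lra|].
    rewrite cos_minus, sin_minus, cos_2PI, sin_2PI, cos_acos, sin_acos by auto.
    split; [ring|].
    replace (1 - X²) with ((-Y)^2) by (unfold Rsqr; lra).
    rewrite sqrt_pow2 by lra. ring.
Qed.

Lemma pm_sqrt_iff r x : 0 <= r -> (pm (sqrt r) x <-> x^2 = r).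
Proof.
  intros Hr. unfold pm. split.
  - intros [-> | ->]; [|replace ((- sqrt r)^2) with (sqrt r ^ 2) by ring];
      apply pow2_sqrt; exact Hr.
  - intros <-. rewrite <- Rsqr_pow2, sqrt_Rsqr_abs.
    destruct (Rle_lt_dec 0 x); [left; rewrite Rabs_right | right; rewrite Rabs_left]; lra.
Qed.

Lemma pm_sqrt_cube P u x : 0 <= P -> 0 <= u -> pm (sqrt (P^2 * u^3)) x ->
  exists X, X^2 = u /\ x = P * X^3.
Proof.
  intros HP Hu Hx.
  assert (E : sqrt (P^2 * u^3) = P * u * sqrt u).
  { replace (P^2 * u^3) with ((P*u) * (P*u) * u) by ring.
    rewrite sqrt_mult, sqrt_square by (positivity; lra). reflexivity. }
  pose proof (pow2_sqrt u Hu) as Hs.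
  rewrite E in Hx. destruct Hx as [-> | ->].
  - exists (sqrt u). split; [exact Hs|].
    replace (sqrt u ^ 3) with (sqrt u ^ 2 * sqrt u) by ring. rewrite Hs. ring.
  - exists (- sqrt u). split; [replace ((- sqrt u) ^ 2) with (sqrt u ^ 2) by ring; exact Hs|].
    replace ((- sqrt u) ^ 3) with (- (sqrt u ^ 2 * sqrt u)) by ring. rewrite Hs. ring.
Qed.

Lemma pow_lt_compat n x y : 0 <= x < y -> x ^ S n < y ^ S n.
Proof.
  intros H. induction n as [|n IH]; [simpl; lra|].
  change (x * x ^ S n < y * y ^ S n). pose proof (pow_le x (S n) (proj1 H)). nra.
Qed.

Lemma Rabs_mul_pow n P X : Rabs (P * X ^ n) = sqrt (P^2 * (X^2)^n).
Proof.
  rewrite <- !pow_mult, Nat.mul_comm, pow_mult.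
  replace (P^2 * (X^n)^2) with ((P * X^n)^2) by ring.
  rewrite <- Rsqr_pow2, sqrt_Rsqr_abs. reflexivity.
Qed.

Lemma sqrt_mul_pow_le_iff n P v w : P <> 0 -> 0 <= v -> 0 <= w ->
  (sqrt (P^2 * v ^ S n) <= sqrt (P^2 * w ^ S n) <-> v <= w).
Proof.
  intros HP Hv Hw. pose proof (pow2_gt_0 P HP).
  pose proof (pow_le v (S n) Hv). pose proof (pow_le w (S n) Hw). split.
  - intros Hs. apply sqrt_le_0 in Hs; try (positivity; lra).
    destruct (Rle_lt_dec v w) as [|Hlt]; [assumption|].
    pose proof (pow_lt_compat n w v (conj Hw Hlt)). nra.
  - intros Hle. apply sqrt_le_1_alt. pose proof (pow_incr v w (S n) (conj Hv Hle)). nra.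
Qed.

(** * Planar curves *)

Definition on_plane_curve (f g : R -> R) (x y : R) : Prop :=
  exists t, 0 <= t < 2*PI /\ f t = x /\ g t = y.

Lemma on_ellipse_iff A B x y : A <> 0 -> B <> 0 ->
  on_plane_curve (fun t => A * cos t) (fun t => B * sin t) x y <->
  x^2/A^2 + y^2/B^2 = 1.
Proof.
  intros HA HB. split.
  - intros [t [_ [<- <-]]]. pose proof (sin2_cos2 t) as Hcs. unfold Rsqr in Hcs.
    field_simplify; [nra | nonzero].
  - intros H. destruct (unit_circle_angle (x/A) (y/B)) as [t [Ht [Ec Es]]].
    { rewrite <- H. field. nonzero. }
    exists t. split; [exact Ht|]. rewrite Ec, Es. split; field; assumption.
Qed.

Lemma on_astroid_iff P Q x y :
  on_plane_curve (fun t => P * cos t ^ 3) (fun t => Q * sin t ^ 3) x y <->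
  exists X Y, X^2 + Y^2 = 1 /\ x = P * X^3 /\ y = Q * Y^3.
Proof.
  split.
  - intros [t [_ [<- <-]]]. exists (cos t), (sin t).
    pose proof (sin2_cos2 t) as Hcs. unfold Rsqr in Hcs. split; [nra | auto].
  - intros [X [Y [H [-> ->]]]]. destruct (unit_circle_angle X Y H) as [t [Ht [<- <-]]].
    exists t. auto.
Qed.

Lemma intersect_at_plane (E : R -> R -> pt) (f1 f2 g1 g2 : R -> R)
    (P : R -> R -> Prop) (S : pt -> Prop) :
  (forall x y x' y', E x y = E x' y' -> x = x' /\ y = y') ->
  (forall p, S p <-> exists x y, p = E x y /\ P x y) ->
  (forall x y, on_plane_curve f1 f2 x y /\ on_plane_curve g1 g2 x y <-> P x y) ->
  intersect_at (fun t => E (f1 t) (f2 t)) (fun t => E (g1 t) (g2 t)) S.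
Proof.
  intros Einj HS H p. rewrite HS. split.
  - intros [[t [Ht <-]] [s [Hs Es]]]. destruct (Einj _ _ _ _ Es) as [Ex Ey].
    exists (f1 t), (f2 t). split; [reflexivity|].
    apply H. split; [exists t | exists s]; auto.
  - intros [x [y [-> Hxy]]].
    destruct (proj2 (H x y) Hxy) as [[t [Ht [<- <-]]] [s [Hs [Ex Ey]]]].
    split; [exists t | exists s]; split; auto. rewrite Ex, Ey. reflexivity.
Qed.

Lemma intersect_at_xy f1 f2 g1 g2 u v :
  (forall x y, on_plane_curve f1 f2 x y /\ on_plane_curve g1 g2 x y <-> pm u x /\ pm v y) ->
  intersect_at (fun t => (f1 t, f2 t, 0)) (fun t => (g1 t, g2 t, 0)) (pts_xy u v).
Proof.
  apply (intersect_at_plane (fun x y => (x, y, 0))).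
  - intros x y x' y' E. injection E. auto.
  - intros [[x y] z]. unfold pts_xy, px, py, pz; cbn. split.
    + intros [Hx [Hy ->]]. exists x, y. auto.
    + intros [x' [y' [E Hxy]]]. injection E as -> -> ->. tauto.
Qed.

Lemma intersect_at_xz f1 f2 g1 g2 u v :
  (forall x z, on_plane_curve f1 f2 x z /\ on_plane_curve g1 g2 x z <-> pm u x /\ pm v z) ->
  intersect_at (fun t => (f1 t, 0, f2 t)) (fun t => (g1 t, 0, g2 t)) (pts_xz u v).
Proof.
  apply (intersect_at_plane (fun x z => (x, 0, z))).
  - intros x z x' z' E. injection E. auto.
  - intros [[x y] z]. unfold pts_xz, px, py, pz; cbn. split.
    + intros [Hx [-> Hz]]. exists x, z. auto.
    + intros [x' [z' [E Hxz]]]. injection E as -> -> ->. tauto.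
Qed.

Lemma intersect_at_yz f1 f2 g1 g2 u v :
  (forall y z, on_plane_curve f1 f2 y z /\ on_plane_curve g1 g2 y z <-> pm u y /\ pm v z) ->
  intersect_at (fun t => (0, f1 t, f2 t)) (fun t => (0, g1 t, g2 t)) (pts_yz u v).
Proof.
  apply (intersect_at_plane (fun y z => (0, y, z))).
  - intros y z y' z' E. injection E. auto.
  - intros [[x y] z]. unfold pts_yz, px, py, pz; cbn. split.
    + intros [-> [Hy Hz]]. exists y, z. auto.
    + intros [y' [z' [E Hyz]]]. injection E as -> -> ->. tauto.
Qed.

(** * Two ellipses in a coordinate plane *)

Lemma linear2_unique a1 b1 a2 b2 X Y : a1*b2 - a2*b1 <> 0 ->
  a1*X + b1*Y = 0 -> a2*X + b2*Y = 0 -> X = 0 /\ Y = 0.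
Proof.
  intros D E1 E2. split; apply (Rmult_eq_reg_r (a1*b2 - a2*b1)); auto.
  - transitivity (b2*(a1*X + b1*Y) - b1*(a2*X + b2*Y)); [ring|]. rewrite E1, E2. ring.
  - transitivity (a1*(a2*X + b2*Y) - a2*(a1*X + b1*Y)); [ring|]. rewrite E1, E2. ring.
Qed.

Definition x0sq p q := p^4 * (p^2 - 2*q^2)^3 / ((p^2 - q^2) * (p^2 + q^2)^3).
Definition y0sq p q := q^4 * (2*p^2 - q^2)^3 / ((p^2 - q^2) * (p^2 + q^2)^3).

Lemma Cdiv_RtoC_pair X1 X2 d : d <> 0 -> ((X1, X2) / RtoC d)%C = (X1 / d, X2 / d).
Proof.
  intros Hd. unfold Cdiv, Cmult, Cinv, RtoC, Re, Im; cbn.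
  apply injective_projections; cbn; field; nonzero.
Qed.

Lemma Cmult_RtoC_pair s X1 X2 : (RtoC s * (X1, X2))%C = (s * X1, s * X2).
Proof. unfold Cmult, RtoC; cbn. apply injective_projections; cbn; ring. Qed.

Section ConicPair.

Variables p q r : R.
Hypothesis hq : 0 < q.
Hypothesis hqp : q < p.
Hypothesis hr : 0 < r.
Hypothesis hpr : p^2 - r^2 <> 0.
Hypothesis hqr : q^2 - r^2 <> 0.
Hypothesis hdet : 2*p^2*q^2 - p^2*r^2 - q^2*r^2 <> 0.

Let hpq2 : q^2 < p^2. Proof. nra. Qed.
Lemma conic_system_homogeneous X Y :
  X/p^2 + Y/q^2 = 0 -> p^2*X/(p^2 - r^2)^2 + q^2*Y/(q^2 - r^2)^2 = 0 -> X = 0 /\ Y = 0.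
Proof.
  intros E1 E2. apply (linear2_unique (/p^2) (/q^2) (p^2/(p^2 - r^2)^2) (q^2/(q^2 - r^2)^2)).
  - replace (/p^2 * (q^2/(q^2 - r^2)^2) - p^2/(p^2 - r^2)^2 * /q^2) with
      (r^2 * (p^2 - q^2) * (2*p^2*q^2 - p^2*r^2 - q^2*r^2)
       / (p^2 * q^2 * (p^2 - r^2)^2 * (q^2 - r^2)^2)) by (field; nonzero).
    nonzero.
  - rewrite <- E1. field. nonzero.
  - rewrite <- E2. field. nonzero.
Qed.

Lemma conic_system_solution :
  xstar2 p q r / p^2 + ystar2 p q r / q^2 = 1 /\
  p^2 * xstar2 p q r / (p^2 - r^2)^2 + q^2 * ystar2 p q r / (q^2 - r^2)^2 = 1.
Proof. unfold xstar2, ystar2. split; field; nonzero. Qed.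

Lemma conic_system_iff X Y :
  X/p^2 + Y/q^2 = 1 /\ p^2*X/(p^2 - r^2)^2 + q^2*Y/(q^2 - r^2)^2 = 1 <->
  X = xstar2 p q r /\ Y = ystar2 p q r.
Proof.
  destruct conic_system_solution as [S1 S2]. split.
  - intros [E1 E2].
    destruct (conic_system_homogeneous (X - xstar2 p q r) (Y - ystar2 p q r)) as [HX HY].
    + transitivity ((X/p^2 + Y/q^2) - (xstar2 p q r / p^2 + ystar2 p q r / q^2));
        [field; nonzero | rewrite E1, S1; ring].
    + transitivity ((p^2*X/(p^2 - r^2)^2 + q^2*Y/(q^2 - r^2)^2)
        - (p^2 * xstar2 p q r / (p^2 - r^2)^2 + q^2 * ystar2 p q r / (q^2 - r^2)^2));
        [field; nonzero | rewrite E2, S2; ring].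
    + split; lra.
  - intros [-> ->]. auto.
Qed.

Lemma ellipses_meet_sq A B x y :
  A^2 = (p^2 - r^2)^2 / p^2 -> B^2 = (q^2 - r^2)^2 / q^2 ->
  on_plane_curve (fun t => p * cos t) (fun t => q * sin t) x y /\
  on_plane_curve (fun t => A * cos t) (fun t => B * sin t) x y <->
  x^2 = xstar2 p q r /\ y^2 = ystar2 p q r.
Proof.
  intros HA HB.
  assert (0 < (p^2 - r^2)^2 / p^2) by (apply Rdiv_lt_0_compat; apply pow2_gt_0; nonzero).
  assert (0 < (q^2 - r^2)^2 / q^2) by (apply Rdiv_lt_0_compat; apply pow2_gt_0; nonzero).
  assert (A <> 0) by (intros ->; lra).
  assert (B <> 0) by (intros ->; lra).
  rewrite !on_ellipse_iff by nonzero.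
  replace (x^2/A^2 + y^2/B^2) with (p^2*x^2/(p^2 - r^2)^2 + q^2*y^2/(q^2 - r^2)^2)
    by (rewrite HA, HB; field; nonzero).
  apply conic_system_iff.
Qed.

Lemma ellipses_meet A B x y :
  A^2 = (p^2 - r^2)^2 / p^2 -> B^2 = (q^2 - r^2)^2 / q^2 ->
  0 <= xstar2 p q r -> 0 <= ystar2 p q r ->
  on_plane_curve (fun t => p * cos t) (fun t => q * sin t) x y /\
  on_plane_curve (fun t => A * cos t) (fun t => B * sin t) x y <->
  pm (sqrt (xstar2 p q r)) x /\ pm (sqrt (ystar2 p q r)) y.
Proof.
  intros HA HB Hx Hy. rewrite ellipses_meet_sq, !pm_sqrt_iff by assumption. reflexivity.
Qed.

Lemma complex_conic_system_iff (X Y : C) :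
  (X / RtoC (p^2) + Y / RtoC (q^2) = 1 /\
   RtoC (p^2) * X / RtoC ((p^2 - r^2)^2) + RtoC (q^2) * Y / RtoC ((q^2 - r^2)^2) = 1)%C <->
  (X = RtoC (xstar2 p q r) /\ Y = RtoC (ystar2 p q r))%C.
Proof.
  destruct X as [X1 X2], Y as [Y1 Y2].
  rewrite !Cmult_RtoC_pair, !Cdiv_RtoC_pair by nonzero. unfold RtoC, Cplus; cbn [fst snd].
  unfold C; rewrite !pair_equal_spec.
  split.
  - intros [[Re1 Im1] [Re2 Im2]].
    destruct (proj1 (conic_system_iff X1 Y1)) as [-> ->]; [split; assumption|].
    destruct (conic_system_homogeneous X2 Y2) as [-> ->]; auto.
  - intros [[-> ->] [-> ->]]. destruct conic_system_solution as [S1 S2].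
    repeat split; try assumption; field; nonzero.
Qed.

Lemma x0sq_sub_xstar2 : x0sq p q - xstar2 p q r =
  p^2 * (r^2*(p^2 + q^2) - 3*p^2*q^2)^2
  / ((p^2 - q^2) * (p^2*r^2 + q^2*r^2 - 2*p^2*q^2) * (p^2 + q^2)^3) * Q6 r p q.
Proof. unfold x0sq, xstar2, Q6. field. nonzero. Qed.

Lemma ystar2_sub_y0sq : ystar2 p q r - y0sq p q = q^2/p^2 * (x0sq p q - xstar2 p q r).
Proof. unfold y0sq, x0sq, xstar2, ystar2. field. nonzero. Qed.

Lemma evolute_points_order : 0 < p^2*r^2 + q^2*r^2 - 2*p^2*q^2 -> 0 <= Q6 r p q ->
  xstar2 p q r <= x0sq p q /\ y0sq p q <= ystar2 p q r.
Proof.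
  intros HD HQ.
  assert (0 <= x0sq p q - xstar2 p q r) by (rewrite x0sq_sub_xstar2; positivity; lra).
  assert (0 <= ystar2 p q r - y0sq p q) by (rewrite ystar2_sub_y0sq; positivity; lra).
  split; lra.
Qed.

Lemma evolute_points_order_rev : 0 < p^2*r^2 + q^2*r^2 - 2*p^2*q^2 ->
  r^2*(p^2 + q^2) - 3*p^2*q^2 <> 0 -> xstar2 p q r <= x0sq p q -> 0 <= Q6 r p q.
Proof.
  intros HD HK Hle. pose proof x0sq_sub_xstar2 as E.
  assert (0 < p^2 * (r^2*(p^2 + q^2) - 3*p^2*q^2)^2
              / ((p^2 - q^2) * (p^2*r^2 + q^2*r^2 - 2*p^2*q^2) * (p^2 + q^2)^3)).
  { apply Rdiv_lt_0_compat; [apply Rmult_lt_0_compat; [|apply pow2_gt_0]|]; positivity; lra. }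
  nra.
Qed.

Lemma evolute_points_eq : r^2*(p^2 + q^2) = 3*p^2*q^2 ->
  x0sq p q = xstar2 p q r /\ y0sq p q = ystar2 p q r.
Proof.
  intros E.
  assert (Z : x0sq p q - xstar2 p q r = 0) by (rewrite x0sq_sub_xstar2, E; unfold Rdiv; ring).
  pose proof ystar2_sub_y0sq as Zy. rewrite Z in Zy.
  split; lra.
Qed.

End ConicPair.

(** * An astroid and an ellipse in a coordinate plane *)

Definition astroid_cubic al be u := al * u^3 + be * (1 - u)^3.

Lemma astroid_cubic_swap al be u : astroid_cubic al be u = astroid_cubic be al (1 - u).
Proof. unfold astroid_cubic. ring. Qed.

Lemma astroid_cubic_roots_ordered al be u w : 0 <= al < 1 -> 1 <= be ->
  0 <= u <= 1 -> 0 <= w <= 1 ->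
  astroid_cubic al be u = 1 -> astroid_cubic al be w = 1 -> u <= w -> u = w.
Proof.
  intros Hal Hbe Hu Hw Eu Ew Hle.
  assert (I : (1 - al) * (w - u)
              + (1 - u) * (1 - w) * (w - u) * (al * (u + w + 1) + be * (2 - u - w)) = 0).
  { transitivity ((astroid_cubic al be u - 1) * (1 - w) - (astroid_cubic al be w - 1) * (1 - u));
      [unfold astroid_cubic; ring | rewrite Eu, Ew; ring]. }
  assert (0 <= (1 - u) * (1 - w) * (w - u) * (al * (u + w + 1) + be * (2 - u - w)))
    by (positivity; lra).
  nra.
Qed.

Lemma astroid_cubic_root_unique al be u w : 0 <= al -> 0 <= be ->
  al < 1 <= be \/ be < 1 <= al -> 0 <= u <= 1 -> 0 <= w <= 1 ->
  astroid_cubic al be u = 1 -> astroid_cubic al be w = 1 -> u = w.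
Proof.
  intros Hal Hbe [[Hal1 Hbe1] | [Hbe1 Hal1]] Hu Hw Eu Ew.
  - destruct (Rle_or_lt u w); [|symmetry];
      apply (astroid_cubic_roots_ordered al be); auto; lra.
  - rewrite astroid_cubic_swap in Eu, Ew.
    enough (1 - u = 1 - w) by lra.
    destruct (Rle_or_lt (1 - u) (1 - w)); [|symmetry];
      apply (astroid_cubic_roots_ordered be al); auto; lra.
Qed.

Lemma astroid_cubic_double_root al be u0 u : 0 < al -> 0 < be ->
  al * u0^2 = be * (1 - u0)^2 -> 0 <= u0 <= 1 -> 0 <= u <= 1 ->
  astroid_cubic al be u = astroid_cubic al be u0 -> u = u0.
Proof.
  intros Hal Hbe E0 Hu0 Hu E.
  assert (I : (u - u0)^2 * (al * (u + 2*u0) + be * (3 - u - 2*u0)) = 0).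
  { transitivity (astroid_cubic al be u - astroid_cubic al be u0
                  - 3 * (al * u0^2 - be * (1 - u0)^2) * (u - u0));
      [unfold astroid_cubic; ring | rewrite E, E0; ring]. }
  assert (0 < al * (u + 2*u0) + be * (3 - u - 2*u0))
    by (destruct (Rle_lt_dec (u + 2*u0) 1); nra).
  apply Rmult_integral in I as [I|I]; [|lra].
  destruct (Req_dec (u - u0) 0) as [Z|Z]; [lra|].
  exfalso. exact (pow_nonzero _ 2 Z I).
Qed.

Lemma astroid_cubic_of_ellipse P Q A B X Y : A <> 0 -> B <> 0 -> X^2 + Y^2 = 1 ->
  astroid_cubic (P^2/A^2) (Q^2/B^2) (X^2) = (P * X^3)^2/A^2 + (Q * Y^3)^2/B^2.
Proof.
  intros HA HB H. unfold astroid_cubic. replace (1 - X^2) with (Y^2) by lra. field. auto.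
Qed.

Lemma astroid_ellipse_meet P Q A B u0 x y :
  0 <= P -> 0 <= Q -> A <> 0 -> B <> 0 -> 0 <= u0 <= 1 ->
  (forall u, 0 <= u <= 1 -> astroid_cubic (P^2/A^2) (Q^2/B^2) u = 1 <-> u = u0) ->
  on_plane_curve (fun t => P * cos t ^ 3) (fun t => Q * sin t ^ 3) x y /\
  on_plane_curve (fun t => A * cos t) (fun t => B * sin t) x y <->
  pm (sqrt (P^2 * u0^3)) x /\ pm (sqrt (Q^2 * (1 - u0)^3)) y.
Proof.
  intros HP HQ HA HB Hu0 Hroot.
  rewrite on_astroid_iff, on_ellipse_iff by assumption. split.
  - intros [[X [Y [HXY [-> ->]]]] He].
    assert (HX : X^2 = u0).
    { apply Hroot; [split; nra|]. rewrite <- He. apply astroid_cubic_of_ellipse; auto. }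
    rewrite !pm_sqrt_iff by (positivity; lra).
    rewrite <- HX. replace (1 - X^2) with (Y^2) by lra. split; ring.
  - intros [Hx Hy].
    destruct (pm_sqrt_cube P u0 x HP ltac:(lra) Hx) as [X [HX ->]].
    destruct (pm_sqrt_cube Q (1 - u0) y HQ ltac:(lra) Hy) as [Y [HY ->]].
    split; [exists X, Y; split; [lra | auto]|].
    rewrite <- (proj2 (Hroot u0 Hu0) eq_refl). unfold astroid_cubic.
    rewrite <- HY, <- HX. field. auto.
Qed.

Definition astroid_root p q r :=
  (p^2 - r^2) * (p^2 + r^2 - 2*q^2) / ((p^2 - q^2) * (p^2 + q^2 - 2*r^2)).

Lemma one_sub_astroid_root p q r : p^2 - q^2 <> 0 -> p^2 + q^2 - 2*r^2 <> 0 ->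
  1 - astroid_root p q r =
  (q^2 - r^2) * (2*p^2 - q^2 - r^2) / ((p^2 - q^2) * (p^2 + q^2 - 2*r^2)).
Proof. intros. unfold astroid_root. field. auto. Qed.

Lemma evolute_ellipse_meet p q r A B x y : 0 < q < p ->
  p^2 - r^2 <> 0 -> q^2 - r^2 <> 0 -> p^2 + q^2 - 2*r^2 <> 0 ->
  A^2 = (p^2 - r^2)^2 / p^2 -> B^2 = (q^2 - r^2)^2 / q^2 ->
  0 <= astroid_root p q r <= 1 ->
  (p^2 - q^2)^2 < (p^2 - r^2)^2 /\ (q^2 - r^2)^2 <= (p^2 - q^2)^2 \/
  (p^2 - q^2)^2 < (q^2 - r^2)^2 /\ (p^2 - r^2)^2 <= (p^2 - q^2)^2 ->
  on_plane_curve (fun t => (p^2 - q^2)/p * cos t ^ 3) (fun t => (p^2 - q^2)/q * sin t ^ 3) x y /\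
  on_plane_curve (fun t => A * cos t) (fun t => B * sin t) x y <->
  pm (x5 p q r) x /\ pm (y5 p q r) y.
Proof.
  intros [hq hqp] hpr hqr hpqr HA HB Hu0 Hamp.
  assert (hpq : 0 < p^2 - q^2) by nra.
  assert (0 < (p^2 - r^2)^2) by (apply pow2_gt_0; exact hpr).
  assert (0 < (q^2 - r^2)^2) by (apply pow2_gt_0; exact hqr).
  assert (A <> 0) by (intros ->; assert (0 < (p^2 - r^2)^2 / p^2) by (positivity; lra); lra).
  assert (B <> 0) by (intros ->; assert (0 < (q^2 - r^2)^2 / q^2) by (positivity; lra); lra).
  set (u0 := astroid_root p q r) in *.
  pose proof (one_sub_astroid_root p q r ltac:(lra) hpqr) as E1u. fold u0 in E1u.
  replace (x5 p q r) with (sqrt (((p^2 - q^2)/p)^2 * u0^3))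
    by (unfold x5, u0, astroid_root; f_equal; field; nonzero).
  replace (y5 p q r) with (sqrt (((p^2 - q^2)/q)^2 * (1 - u0)^3))
    by (rewrite E1u; unfold y5; f_equal; field; nonzero).
  apply astroid_ellipse_meet; auto; try (positivity; lra).
  replace (((p^2 - q^2)/p)^2 / A^2) with ((p^2 - q^2)^2 / (p^2 - r^2)^2)
    by (rewrite HA; field; nonzero).
  replace (((p^2 - q^2)/q)^2 / B^2) with ((p^2 - q^2)^2 / (q^2 - r^2)^2)
    by (rewrite HB; field; nonzero).
  assert (Root : astroid_cubic ((p^2 - q^2)^2 / (p^2 - r^2)^2)
                               ((p^2 - q^2)^2 / (q^2 - r^2)^2) u0 = 1)
    by (unfold astroid_cubic; rewrite E1u; unfold u0, astroid_root; field; nonzero).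
  intros u Hu. split; [intros Hr | intros ->; exact Root].
  apply (astroid_cubic_root_unique ((p^2 - q^2)^2 / (p^2 - r^2)^2) ((p^2 - q^2)^2 / (q^2 - r^2)^2));
    auto; try (positivity; lra).
  destruct Hamp as [[Ha1 Ha2] | [Ha1 Ha2]]; [left | right];
    (split; [apply Rlt_div_l | apply Rle_div_r]); lra.
Qed.

Lemma ellipse_evolute_meet p q x y : 0 < q < p -> 2*q^2 <= p^2 ->
  on_plane_curve (fun t => p * cos t) (fun t => q * sin t) x y /\
  on_plane_curve (fun t => (p^2 - q^2)/p * cos t ^ 3) (fun t => (p^2 - q^2)/q * sin t ^ 3) x y <->
  pm (x0 p q) x /\ pm (y0 p q) y.
Proof.
  intros [hq hqp] H. rewrite and_comm.
  assert (hpq : 0 < p^2 - q^2) by nra.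
  replace (x0 p q) with (x5 p q 0) by (unfold x0, x5; f_equal; field; nonzero).
  replace (y0 p q) with (y5 p q 0) by (unfold y0, y5; f_equal; field; nonzero).
  apply evolute_ellipse_meet; try nonzero; try (field; nonzero); try lra.
  - unfold astroid_root. positivity; nra.
  - assert (0 <= 1 - astroid_root p q 0); [|lra].
    rewrite one_sub_astroid_root by nonzero. positivity; nra.
  - assert (0 < q^2) by positivity. left. split; nra.
Qed.

(** * The ellipsoid *)

Lemma x3_xstar2 a b c : x3 a b c = sqrt (xstar2 a c b).
Proof.
  unfold x3, xstar2.
  replace (2*a^2*c^2 - a^2*b^2 - c^2*b^2) with (2*a^2*c^2 - a^2*b^2 - b^2*c^2) by ring.
  reflexivity.
Qed.

Lemma z3_ystar2 a b c : z3 a b c = sqrt (ystar2 a c b).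
Proof.
  unfold z3, ystar2.
  replace (2*a^2*c^2 - c^2*b^2 - a^2*b^2) with (2*a^2*c^2 - a^2*b^2 - b^2*c^2) by ring.
  reflexivity.
Qed.

Lemma y4_xstar2 a b c : y4 a b c = sqrt (xstar2 b c a).
Proof.
  unfold y4, xstar2.
  replace (2*b^2*c^2 - b^2*a^2 - c^2*a^2) with (2*b^2*c^2 - a^2*b^2 - a^2*c^2) by ring.
  reflexivity.
Qed.

Lemma z4_ystar2 a b c : z4 a b c = sqrt (ystar2 b c a).
Proof.
  unfold z4, ystar2.
  replace (2*b^2*c^2 - c^2*a^2 - b^2*a^2) with (2*b^2*c^2 - a^2*b^2 - a^2*c^2) by ring.
  reflexivity.
Qed.

Lemma caustic_sheets_of_curvatures a b c p k1 k2 :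
  principal_curvature a b c p k1 -> principal_curvature a b c p k2 ->
  (forall k, principal_curvature a b c p k -> k = k1 \/ k = k2) -> k1 <= k2 ->
  caustic_sheet1 a b c (curv_center a b c p k1) /\ caustic_sheet2 a b c (curv_center a b c p k2).
Proof.
  intros K1 K2 Kall Hle. split.
  - exists p, k1. split; [exact K1|]. split; [|reflexivity].
    intros k Hk. destruct (Kall k Hk) as [-> | ->]; lra.
  - exists p, k2. split; [exact K2|]. split; [|reflexivity].
    intros k Hk. destruct (Kall k Hk) as [-> | ->]; lra.
Qed.

Lemma position_of_ellF a b c p k s : 0 < k -> ellF a b c p = 1 + k * s ->
  (s = 0 -> on_E a b c p) /\ (s < 0 -> inside_E a b c p) /\ (s > 0 -> outside_E a b c p).
Proof.
  intros Hk E. unfold on_E, inside_E, outside_E. rewrite E.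
  split; [|split]; intros Hs; [rewrite Hs; ring | nra | nra].
Qed.

(* Obtained by dividing the numerator of [ellF - 1] at the points of (9) by [Q6];
   its coefficients are nonnegative. *)
Definition Q6_cofactor u w C := 9*u^3*C^3 + w^3*C^3 + 3*w^4*C^2 + 3*w^5*C + w^6 + 7*u*w^2*C^3
  + 21*u*w^3*C^2 + 21*u*w^4*C + 7*u*w^5 + 15*u^2*w*C^3 + 51*u^2*w^2*C^2 + 54*u^2*w^3*C
  + 18*u^2*w^4 + 51*u^3*w*C^2 + 60*u^3*w^2*C + 20*u^3*w^3 + 18*u^4*C^2 + 24*u^4*w*C
  + 8*u^4*w^2.

Section Ellipsoid.

Variables a b c : R.
Hypothesis hab : a > b.
Hypothesis hbc : b > c.
Hypothesis hc : c > 0.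

Let ha : 0 < a. Proof. lra. Qed.
Let hab2 : b^2 < a^2. Proof. nra. Qed.
Let hbc2 : c^2 < b^2. Proof. nra. Qed.
Let hc2 : 0 < c^2. Proof. nra. Qed.

Lemma ellipse1_astroida4_meet : a^2 >= 2*b^2 ->
  intersect_at (ellipse1 a b c) (astroida4 a b c) (pts_xy (x0 a b) (y0 a b)).
Proof. intros H. apply intersect_at_xy. intros x y. apply ellipse_evolute_meet; lra. Qed.

Lemma ellipse2_astroida5_meet : a^2 >= 2*c^2 ->
  intersect_at (ellipse2 a b c) (astroida5 a b c) (pts_xz (x1 a c) (z1 a c)).
Proof. intros H. apply intersect_at_xz. intros x z. apply ellipse_evolute_meet; lra. Qed.

Lemma ellipse3_astroida6_meet : b^2 >= 2*c^2 ->
  intersect_at (ellipse3 a b c) (astroida6 a b c) (pts_yz (y2 b c) (z2 b c)).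
Proof. intros H. apply intersect_at_yz. intros y z. apply ellipse_evolute_meet; lra. Qed.

Lemma astroida4_ellipse7_meet : a^2 + c^2 >= 2*b^2 ->
  intersect_at (astroida4 a b c) (ellipse7 a b c) (pts_xy (x5 a b c) (y5 a b c)).
Proof.
  intros H. apply intersect_at_xy. intros x y.
  apply evolute_ellipse_meet; try nonzero; try (field; nonzero); try lra.
  - unfold astroid_root. positivity; nra.
  - assert (0 <= 1 - astroid_root a b c); [|lra].
    rewrite one_sub_astroid_root by nonzero. positivity; nra.
  - left. split; nra.
Qed.

Lemma astroida6_ellipse9_meet : a^2 + c^2 <= 2*b^2 ->
  intersect_at (astroida6 a b c) (ellipse9 a b c) (pts_yz (y7 a b c) (z7 a b c)).
Proof.
  intros H. apply intersect_at_yz. intros y z.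
  apply evolute_ellipse_meet; try nonzero; try (field; nonzero); try lra.
  - replace (astroid_root b c a)
      with ((a^2 - b^2) * (a^2 + b^2 - 2*c^2) / ((b^2 - c^2) * (2*a^2 - b^2 - c^2)))
      by (unfold astroid_root; field; nonzero).
    positivity; nra.
  - assert (0 <= 1 - astroid_root b c a); [|lra].
    rewrite one_sub_astroid_root by nonzero.
    replace ((c^2 - a^2) * (2*b^2 - c^2 - a^2) / ((b^2 - c^2) * (b^2 + c^2 - 2*a^2)))
      with ((a^2 - c^2) * (2*b^2 - c^2 - a^2) / ((b^2 - c^2) * (2*a^2 - b^2 - c^2)))
      by (field; nonzero).
    positivity; nra.
  - right. split; nra.
Qed.

Let hdet_xy : 0 < 2*a^2*b^2 - a^2*c^2 - b^2*c^2.
Proof. nra. Qed.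

Lemma ystar2_neg : ystar2 a b c < 0.
Proof.
  unfold ystar2.
  replace (b^2 * (b^2 - c^2)^2 * (2*a^2 - c^2) / ((b^2 - a^2) * (2*a^2*b^2 - b^2*c^2 - a^2*c^2)))
    with (- (b^2 * (b^2 - c^2)^2 * (2*a^2 - c^2) / ((a^2 - b^2) * (2*a^2*b^2 - a^2*c^2 - b^2*c^2))))
    by (field; nonzero).
  assert (0 < b^2 * (b^2 - c^2)^2 * (2*a^2 - c^2) / ((a^2 - b^2) * (2*a^2*b^2 - a^2*c^2 - b^2*c^2)))
    by (positivity; lra).
  lra.
Qed.

Lemma ellipse1_ellipse7_disjoint p :
  ~ (on_curve (ellipse1 a b c) p /\ on_curve (ellipse7 a b c) p).
Proof.
  destruct p as [[x y] z]. intros [[t [Ht Et]] [s [Hs Es]]].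
  unfold ellipse1, ellipse7 in Et, Es. injection Et as Ex Ey _. injection Es as Ex' Ey' _.
  assert (Hmeet : on_plane_curve (fun t => a * cos t) (fun t => b * sin t) x y /\
                  on_plane_curve (fun t => (a^2 - c^2)/a * cos t)
                                 (fun t => (b^2 - c^2)/b * sin t) x y)
    by (split; [exists t | exists s]; auto).
  rewrite (ellipses_meet_sq a b c) in Hmeet by (try nonzero; try (field; nonzero); lra).
  destruct Hmeet as [_ Hy].
  pose proof ystar2_neg. pose proof (pow2_ge_0 y). lra.
Qed.

Lemma ellipse1_ellipse7_complex_meet (x y : C) :
  (x * x / RtoC (a^2) + y * y / RtoC (b^2) = 1 /\
   RtoC (a^2) * (x * x) / RtoC ((a^2 - c^2)^2)
     + RtoC (b^2) * (y * y) / RtoC ((b^2 - c^2)^2) = 1)%C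
  <-> (x * x = RtoC (xstar2 a b c) /\ y * y = RtoC (ystar2 a b c))%C.
Proof. apply complex_conic_system_iff; try nonzero; lra. Qed.

Lemma ellipse2_ellipse8_meet : b^2 >= 2*c^2 ->
  intersect_at (ellipse2 a b c) (ellipse8 a b c) (pts_xz (x3 a b c) (z3 a b c)) /\
  x1 a c >= x3 a b c /\ z1 a c <= z3 a b c /\
  (1 / a^2 + 1 / c^2 = 3 / b^2 -> x1 a c = x3 a b c /\ z1 a c = z3 a b c).
Proof.
  intros H. rewrite x3_xstar2, z3_ystar2.
  assert (HD : 0 < a^2*b^2 + c^2*b^2 - 2*a^2*c^2) by nra.
  assert (Hdet : 2*a^2*c^2 - a^2*b^2 - c^2*b^2 <> 0) by lra.
  split; [|split; [|split]].
  - apply intersect_at_xz. intros x z.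
    apply (ellipses_meet a c b); try nonzero; try (field; nonzero); try lra.
    + replace (xstar2 a c b) with (a^2 * (a^2 - b^2)^2 * (b^2 - 2*c^2)
                                   / ((a^2 - c^2) * (a^2*b^2 + c^2*b^2 - 2*a^2*c^2)))
        by (unfold xstar2; field; nonzero).
      positivity; lra.
    + replace (ystar2 a c b) with (c^2 * (b^2 - c^2)^2 * (2*a^2 - b^2)
                                   / ((a^2 - c^2) * (a^2*b^2 + c^2*b^2 - 2*a^2*c^2)))
        by (unfold ystar2; field; nonzero).
      positivity; nra.
  - apply Rle_ge, sqrt_le_1_alt, (evolute_points_order a c b); try nonzero; try lra.
    unfold Q6. nra.
  - apply sqrt_le_1_alt, (evolute_points_order a c b); try nonzero; try lra.
    unfold Q6. nra.
  - intros E.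
    assert (Eb : b^2*(a^2 + c^2) = 3*a^2*c^2).
    { apply (Rmult_eq_reg_r (/ (a^2*b^2*c^2))); [|nonzero].
      transitivity (1/a^2 + 1/c^2); [field; nonzero|]. rewrite E. field. nonzero. }
    assert (Heq : x0sq a c = xstar2 a c b /\ y0sq a c = ystar2 a c b)
      by (apply evolute_points_eq; try nonzero; lra).
    destruct Heq as [Ex Ez].
    change (sqrt (x0sq a c) = sqrt (xstar2 a c b) /\ sqrt (y0sq a c) = sqrt (ystar2 a c b)).
    rewrite Ex, Ez. split; reflexivity.
Qed.

Lemma ellipse3_ellipse9_meet : 2*b^2 >= a^2 -> a^2 >= 2*c^2 ->
  intersect_at (ellipse3 a b c) (ellipse9 a b c) (pts_yz (y4 a b c) (z4 a b c)) /\
  (b^2 >= 2*c^2 -> (y2 b c >= y4 a b c /\ z2 b c <= z4 a b c <-> Q6 a b c >= 0)).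
Proof.
  intros H1 H2. rewrite y4_xstar2, z4_ystar2.
  assert (HD : 0 < b^2*a^2 + c^2*a^2 - 2*b^2*c^2) by nra.
  assert (Hdet : 2*b^2*c^2 - b^2*a^2 - c^2*a^2 <> 0) by lra.
  assert (Hx : 0 <= xstar2 b c a).
  { replace (xstar2 b c a) with (b^2 * (a^2 - b^2)^2 * (a^2 - 2*c^2)
                                 / ((b^2 - c^2) * (b^2*a^2 + c^2*a^2 - 2*b^2*c^2)))
      by (unfold xstar2; field; nonzero).
    positivity; lra. }
  split.
  - apply intersect_at_yz. intros y z.
    apply (ellipses_meet b c a); try nonzero; try (field; nonzero); try lra.
    replace (ystar2 b c a) with (c^2 * (a^2 - c^2)^2 * (2*b^2 - a^2)
                                 / ((b^2 - c^2) * (b^2*a^2 + c^2*a^2 - 2*b^2*c^2)))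
      by (unfold ystar2; field; nonzero).
    positivity; lra.
  - intros H3. change (y2 b c) with (sqrt (x0sq b c)). change (z2 b c) with (sqrt (y0sq b c)).
    split.
    + intros [Hy _]. apply Rle_ge, (evolute_points_order_rev b c a); try nonzero; try lra.
      apply sqrt_le_0; try lra. unfold x0sq. positivity; lra.
    + intros HQ.
      assert (Hord : xstar2 b c a <= x0sq b c /\ y0sq b c <= ystar2 b c a)
        by (apply evolute_points_order; try nonzero; lra).
      destruct Hord as [Hy Hz]. split; [apply Rle_ge|]; apply sqrt_le_1_alt; assumption.
Qed.

Definition tangency_cos2 := (a^2 - b^2) / (a^2 - c^2).

Let htangency : 0 < tangency_cos2 < 1.
Proof.
  unfold tangency_cos2. split; [positivity; lra|]. apply Rlt_div_l; lra.
Qed.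

Lemma tangency_cos2_double_root u : 0 <= u <= 1 ->
  astroid_cubic (((a^2 - c^2)/a)^2 / ((a^2 - b^2)/a)^2)
                (((a^2 - c^2)/c)^2 / ((b^2 - c^2)/c)^2) u = 1 ->
  u = tangency_cos2.
Proof.
  intros Hu E.
  apply (astroid_cubic_double_root (((a^2 - c^2)/a)^2 / ((a^2 - b^2)/a)^2)
                                   (((a^2 - c^2)/c)^2 / ((b^2 - c^2)/c)^2)); try lra.
  - positivity; lra.
  - positivity; lra.
  - unfold tangency_cos2. field. nonzero.
  - rewrite E. unfold astroid_cubic, tangency_cos2. field. nonzero.
Qed.

Lemma astroida5_ellipse8_meet :
  intersect_at (astroida5 a b c) (ellipse8 a b c) (pts_xz (x6 a b c) (z6 a b c)).
Proof.
  apply intersect_at_xz. intros x z.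
  replace (x6 a b c) with (sqrt (((a^2 - c^2)/a)^2 * tangency_cos2^3))
    by (unfold x6, tangency_cos2; f_equal; field; nonzero).
  replace (z6 a b c) with (sqrt (((a^2 - c^2)/c)^2 * (1 - tangency_cos2)^3))
    by (unfold z6, tangency_cos2; f_equal; field; nonzero).
  apply astroid_ellipse_meet; try (positivity; lra); try nonzero; try lra.
  intros u Hu. split; [apply tangency_cos2_double_root; assumption|].
  intros ->. unfold astroid_cubic, tangency_cos2. field. nonzero.
Qed.

Lemma astroida5_deriv t : curve_deriv (astroida5 a b c) t
  (- (3 * ((a^2 - c^2)/a) * cos t ^ 2 * sin t), 0, 3 * ((a^2 - c^2)/c) * sin t ^ 2 * cos t).
Proof.
  unfold curve_deriv, astroida5, px, py, pz; cbn [fst snd].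
  split; [|split]; auto_derive; auto; field; nonzero.
Qed.

Lemma ellipse8_deriv s : curve_deriv (ellipse8 a b c) s
  (- ((a^2 - b^2)/a * sin s), 0, (b^2 - c^2)/c * cos s).
Proof.
  unfold curve_deriv, ellipse8, px, py, pz; cbn [fst snd].
  split; [|split]; auto_derive; auto; field; nonzero.
Qed.

Lemma astroida5_ellipse8_common_cos2 t s : astroida5 a b c t = ellipse8 a b c s ->
  cos t ^ 2 = tangency_cos2.
Proof.
  intros E. pose proof (f_equal px E) as Ex. pose proof (f_equal pz E) as Ez.
  unfold astroida5, ellipse8, px, pz in Ex, Ez; cbn [fst snd] in Ex, Ez.
  assert (HCS : cos t ^ 2 + sin t ^ 2 = 1) by (rewrite <- (sin2_cos2 t); unfold Rsqr; ring).
  assert (Hs2 : cos s ^ 2 + sin s ^ 2 = 1) by (rewrite <- (sin2_cos2 s); unfold Rsqr; ring).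
  apply tangency_cos2_double_root; [split; nra|].
  rewrite (astroid_cubic_of_ellipse _ _ _ _ (cos t) (sin t)) by (nonzero || lra).
  rewrite Ex, Ez, <- Hs2. field. nonzero.
Qed.

Lemma astroida5_ellipse8_tangent p : pts_xz (x6 a b c) (z6 a b c) p ->
  tangent_at (astroida5 a b c) (ellipse8 a b c) p.
Proof.
  intros Hp. destruct (proj2 (astroida5_ellipse8_meet p) Hp) as [[t [Ht Et]] [s [Hs Es]]].
  assert (Ets : astroida5 a b c t = ellipse8 a b c s) by congruence.
  pose proof (astroida5_ellipse8_common_cos2 t s Ets) as HC.
  pose proof (f_equal px Ets) as Ex. pose proof (f_equal pz Ets) as Ez.
  unfold astroida5, ellipse8, px, pz in Ex, Ez; cbn [fst snd] in Ex, Ez.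
  set (P := (a^2 - c^2)/a) in *. set (Q := (a^2 - c^2)/c) in *.
  set (A := (a^2 - b^2)/a) in *. set (B := (b^2 - c^2)/c) in *.
  assert (HP : 0 < P) by (unfold P; positivity; lra).
  assert (HA : 0 < A) by (unfold A; positivity; lra).
  assert (HB : 0 < B) by (unfold B; positivity; lra).
  set (C := cos t) in *. set (S := sin t) in *.
  assert (HCS : C^2 + S^2 = 1) by (unfold C, S; rewrite <- (sin2_cos2 t); unfold Rsqr; ring).
  assert (Hs2 : cos s ^ 2 + sin s ^ 2 = 1) by (rewrite <- (sin2_cos2 s); unfold Rsqr; ring).
  assert (HC0 : C <> 0) by (intros E; rewrite E in HC; lra).
  assert (HS0 : S <> 0) by (intros E; rewrite E in HCS; lra).
  exists t, s, (- (3*P*C^2*S), 0, 3*Q*S^2*C), (- (A*sin s), 0, B*cos s).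
  do 4 (split; [assumption|]).
  split; [apply astroida5_deriv|]. split; [apply ellipse8_deriv|].
  split; [|split].
  - intros Z. injection Z as Z1 _. apply HS0.
    apply (Rmult_eq_reg_l (3*P*C^2)); [lra | nonzero].
  - intros Z. injection Z as Z1 Z3.
    assert (sin s = 0) by nra. assert (cos s = 0) by nra. nra.
  - unfold cross, zero_pt, px, py, pz; cbn [fst snd].
    apply injective_projections; [apply injective_projections|]; cbn [fst snd]; try ring.
    replace (cos s) with (P * C^3 / A) by (rewrite Ex; field; lra).
    replace (sin s) with (Q * S^3 / B) by (rewrite Ez; field; lra).
    (* parallel velocities: the double root also satisfies P^2 C^4 / A^2 = Q^2 S^4 / B^2 *)
    transitivity (3*S*C*A*B*(P^2*(C^2)^2/A^2 - Q^2*(S^2)^2/B^2)); [field; lra|].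
    replace (S^2) with (1 - C^2) by lra. rewrite HC.
    unfold P, Q, A, B, tangency_cos2. field. nonzero.
Qed.

(** * Principal curvatures along the section y = 0 *)

Definition normal_sq C S := C^2/a^2 + S^2/c^2.
Definition kappa_xz C S := 1 / (a^2 * c^2 * normal_sq C S * sqrt (normal_sq C S)).
Definition kappa_y C S := 1 / (b^2 * sqrt (normal_sq C S)).

Lemma normal_sq_pos C S : C^2 + S^2 = 1 -> 0 < normal_sq C S.
Proof.
  intros H. unfold normal_sq.
  assert (0 <= C^2/a^2) by (positivity; lra). assert (0 <= S^2/c^2) by (positivity; lra).
  destruct (Req_dec C 0) as [->|HC].
  - assert (0 < S^2/c^2); [apply Rdiv_lt_0_compat; nra | lra].
  - assert (0 < C^2/a^2); [apply Rdiv_lt_0_compat; [apply pow2_gt_0; exact HC | positivity] | lra].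
Qed.

Lemma vnorm_normalN C S : vnorm (normalN a b c (a*C, 0, c*S)) = sqrt (normal_sq C S).
Proof.
  unfold vnorm, dot, normalN, px, py, pz, normal_sq; cbn [fst snd]. f_equal. field. nonzero.
Qed.

Lemma on_E_xz_section C S : C^2 + S^2 = 1 -> on_E a b c (a*C, 0, c*S).
Proof. intros H. unfold on_E, ellF, px, py, pz; cbn [fst snd]. rewrite <- H. field. nonzero. Qed.

Lemma principal_curvature_y C S : C^2 + S^2 = 1 ->
  principal_curvature a b c (a*C, 0, c*S) (kappa_y C S).
Proof.
  intros H. pose proof (sqrt_lt_R0 _ (normal_sq_pos C S H)).
  split; [apply on_E_xz_section; exact H|].
  exists (0, 1, 0). split; [|split].
  - intros E. injection E. lra.
  - unfold dot, normalN, px, py, pz; cbn [fst snd]. field. nonzero.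
  - exists 0. rewrite vnorm_normalN. unfold kappa_y, hessD, vadd, vscale, normalN, px, py, pz.
    cbn [fst snd]. f_equal; [f_equal|]; field; nonzero.
Qed.

Lemma principal_curvature_xz C S : C^2 + S^2 = 1 ->
  principal_curvature a b c (a*C, 0, c*S) (kappa_xz C S).
Proof.
  intros H. pose proof (normal_sq_pos C S H) as HN. pose proof (sqrt_lt_R0 _ HN) as Hn.
  split; [apply on_E_xz_section; exact H|].
  exists (S/c, 0, -C/a). split; [|split].
  - intros E. pose proof (f_equal px E) as Ex. pose proof (f_equal pz E) as Ez.
    unfold px, pz, zero_pt in Ex, Ez; cbn [fst snd] in Ex, Ez.
    assert (S = 0) by (replace S with (S/c * c) by (field; nonzero); rewrite Ex; ring).
    assert (C = 0) by (replace C with (- (-C/a) * a) by (field; nonzero); rewrite Ez; ring).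
    subst. lra.
  - unfold dot, normalN, px, py, pz; cbn [fst snd]. field. nonzero.
  - exists (S*C*(c^2 - a^2) / (a^3*c^3*normal_sq C S)). rewrite vnorm_normalN.
    unfold kappa_xz. rewrite <- H at 1.
    unfold hessD, vadd, vscale, normalN, px, py, pz; cbn [fst snd].
    assert (HaN : a^2*c^2*normal_sq C S = (C*c)^2 + (S*a)^2) by (unfold normal_sq; field; nonzero).
    assert ((C*c)^2 + (S*a)^2 <> 0) by (rewrite <- HaN; nonzero).
    unfold normal_sq in *. f_equal; [f_equal|]; field; nonzero.
Qed.

Lemma tangent_xz_quadratic_form C S v1 v3 : C^2 + S^2 = 1 -> v1*C/a + v3*S/c = 0 ->
  (v1^2/a^2 + v3^2/c^2) * normal_sq C S = (v1^2 + v3^2) / (a^2*c^2).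
Proof.
  intros H Ht.
  transitivity ((v1^2 + v3^2)*(C^2 + S^2)/(a^2*c^2)
                + (1/a^2 - 1/c^2)*(v1*C/a - v3*S/c)*(v1*C/a + v3*S/c));
    [unfold normal_sq; field; nonzero | rewrite Ht, H; field; nonzero].
Qed.

Lemma principal_curvature_cases C S k : C^2 + S^2 = 1 ->
  principal_curvature a b c (a*C, 0, c*S) k -> k = kappa_xz C S \/ k = kappa_y C S.
Proof.
  intros H [_ [[[v1 v2] v3] [Hv [Hdot [mu Heq]]]]].
  pose proof (normal_sq_pos C S H) as HN. pose proof (sqrt_lt_R0 _ HN) as Hn.
  rewrite vnorm_normalN in Heq. set (n := sqrt (normal_sq C S)) in *.
  pose proof (f_equal px Heq) as E1. pose proof (f_equal py Heq) as E2.
  pose proof (f_equal pz Heq) as E3.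
  unfold hessD, vadd, vscale, normalN, dot, px, py, pz in E1, E2, E3, Hdot; cbn [fst snd] in *.
  destruct (Req_dec v2 0) as [->|Hv2].
  - left.
    assert (HW : 0 < v1^2 + v3^2).
    { destruct (Req_dec v1 0) as [->|Z1]; [destruct (Req_dec v3 0) as [->|Z3]|].
      - exfalso. apply Hv. reflexivity.
      - pose proof (pow2_gt_0 _ Z3). nra.
      - pose proof (pow2_gt_0 _ Z1). nra. }
    assert (Hq : v1^2/a^2 + v3^2/c^2 = k*n*(v1^2 + v3^2)).
    { transitivity (v1*(v1/a^2) + v3*(v3/c^2)); [field; nonzero|].
      rewrite E1, E3.
      transitivity (k*n*(v1^2 + v3^2) + mu*(v1*(a*C/a^2) + 0*(0/b^2) + v3*(c*S/c^2))); [ring|].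
      rewrite Hdot. ring. }
    assert (Ht : v1*C/a + v3*S/c = 0) by (rewrite <- Hdot; field; nonzero).
    pose proof (tangent_xz_quadratic_form C S v1 v3 H Ht) as L. rewrite Hq in L.
    assert (K : k*n*normal_sq C S = 1/(a^2*c^2)).
    { apply (Rmult_eq_reg_l (v1^2 + v3^2)); [|lra].
      transitivity (k*n*(v1^2 + v3^2)*normal_sq C S); [ring|]. rewrite L. field. nonzero. }
    unfold kappa_xz. fold n.
    replace k with (k*n*normal_sq C S / (n*normal_sq C S)) by (field; nonzero).
    rewrite K. field. nonzero.
  - right.
    assert (K : k*n = 1/b^2).
    { apply (Rmult_eq_reg_l v2); auto.
      transitivity (k*n*v2 + mu*(0/b^2)); [field; nonzero|]. rewrite <- E2. field. nonzero. }
    unfold kappa_y. fold n. replace k with (k*n/n) by (field; nonzero).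
    rewrite K. field. nonzero.
Qed.

Lemma curv_center_xz C S : C^2 + S^2 = 1 ->
  curv_center a b c (a*C, 0, c*S) (kappa_xz C S) =
  ((a^2 - c^2)/a * C^3, 0, - ((a^2 - c^2)/c) * S^3).
Proof.
  intros H. pose proof (normal_sq_pos C S H) as HN. pose proof (sqrt_lt_R0 _ HN) as Hn.
  unfold curv_center, kappa_xz. rewrite vnorm_normalN.
  unfold vadd, vscale, normalN, px, py, pz; cbn [fst snd].
  apply injective_projections; [apply injective_projections|]; cbn [fst snd].
  - transitivity (a*C - a*c^2*C*normal_sq C S); [field; nonzero|].
    unfold normal_sq. replace (S^2) with (1 - C^2) by lra. field. nonzero.
  - field. nonzero.
  - transitivity (c*S - a^2*c*S*normal_sq C S); [field; nonzero|].
    unfold normal_sq. replace (C^2) with (1 - S^2) by lra. field. nonzero.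
Qed.

Lemma curv_center_y C S : C^2 + S^2 = 1 ->
  curv_center a b c (a*C, 0, c*S) (kappa_y C S) =
  ((a^2 - b^2)/a * C, 0, - ((b^2 - c^2)/c) * S).
Proof.
  intros H. pose proof (sqrt_lt_R0 _ (normal_sq_pos C S H)) as Hn.
  unfold curv_center, kappa_y. rewrite vnorm_normalN.
  unfold vadd, vscale, normalN, px, py, pz; cbn [fst snd].
  apply injective_projections; [apply injective_projections|]; cbn [fst snd]; field; nonzero.
Qed.

Lemma kappa_xz_sub_kappa_y C S : C^2 + S^2 = 1 ->
  kappa_xz C S - kappa_y C S =
  (a^2 - c^2) * (C^2 - tangency_cos2) / (a^2*b^2*c^2*normal_sq C S*sqrt (normal_sq C S)).
Proof.
  intros H. pose proof (normal_sq_pos C S H) as HN. pose proof (sqrt_lt_R0 _ HN) as Hn.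
  transitivity ((b^2 - a^2*c^2*normal_sq C S)
                / (a^2*b^2*c^2*normal_sq C S*sqrt (normal_sq C S)));
    [unfold kappa_xz, kappa_y; field; nonzero|].
  unfold Rdiv. f_equal. unfold normal_sq, tangency_cos2.
  replace (S^2) with (1 - C^2) by lra. field. nonzero.
Qed.

Lemma curvature_centers_on_sheets C S : C^2 + S^2 = 1 ->
  let p := (a*C, 0, c*S) in
  (tangency_cos2 <= C^2 ->
     caustic_sheet1 a b c (curv_center a b c p (kappa_y C S)) /\
     caustic_sheet2 a b c (curv_center a b c p (kappa_xz C S))) /\
  (C^2 <= tangency_cos2 ->
     caustic_sheet1 a b c (curv_center a b c p (kappa_xz C S)) /\
     caustic_sheet2 a b c (curv_center a b c p (kappa_y C S))).
Proof.
  intros H p. pose proof (normal_sq_pos C S H) as HN. pose proof (sqrt_lt_R0 _ HN) as Hn.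
  pose proof (kappa_xz_sub_kappa_y C S H) as D.
  assert (Hd : 0 < a^2*b^2*c^2*normal_sq C S*sqrt (normal_sq C S)) by (positivity; lra).
  pose proof (principal_curvature_xz C S H) as Kxz. pose proof (principal_curvature_y C S H) as Ky.
  assert (Kall : forall k, principal_curvature a b c p k -> k = kappa_xz C S \/ k = kappa_y C S)
    by (intros k; apply principal_curvature_cases, H).
  split; intros Hc; apply caustic_sheets_of_curvatures; auto;
    try (intros k Hk; destruct (Kall k Hk); auto).
  - assert (0 <= (a^2 - c^2) * (C^2 - tangency_cos2)
                 / (a^2*b^2*c^2*normal_sq C S*sqrt (normal_sq C S))) by (positivity; lra).
    lra.
  - assert (0 <= (a^2 - c^2) * (tangency_cos2 - C^2)
                 / (a^2*b^2*c^2*normal_sq C S*sqrt (normal_sq C S))) by (positivity; lra).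
    assert (E : (a^2 - c^2) * (tangency_cos2 - C^2)
                / (a^2*b^2*c^2*normal_sq C S*sqrt (normal_sq C S))
              = - (kappa_xz C S - kappa_y C S)) by (rewrite D; field; lra).
    lra.
Qed.

Lemma x6_threshold n P X : P <> 0 -> x6 a b c = sqrt (P^2 * tangency_cos2 ^ S n) ->
  (Rabs (P * X ^ S n) >= x6 a b c -> tangency_cos2 <= X^2) /\
  (Rabs (P * X ^ S n) <= x6 a b c -> X^2 <= tangency_cos2).
Proof.
  intros HP Hx6. rewrite Hx6, Rabs_mul_pow. pose proof (pow2_ge_0 X).
  split; intros Hc; [apply Rge_le in Hc|]; apply sqrt_mul_pow_le_iff in Hc; auto; lra.
Qed.

Lemma astroida5_ellipse8_sheets :
  let S := caustic_sheet1 a b c in let T := caustic_sheet2 a b c in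
  let outer p := Rabs (px p) >= x6 a b c in
  let inner p := Rabs (px p) <= x6 a b c in
  ((forall p, on_curve (astroida5 a b c) p -> outer p -> S p) /\
   (forall p, on_curve (astroida5 a b c) p -> inner p -> T p) \/
   (forall p, on_curve (astroida5 a b c) p -> outer p -> T p) /\
   (forall p, on_curve (astroida5 a b c) p -> inner p -> S p)) /\
  ((forall p, on_curve (ellipse8 a b c) p -> outer p -> S p) /\
   (forall p, on_curve (ellipse8 a b c) p -> inner p -> T p) \/
   (forall p, on_curve (ellipse8 a b c) p -> outer p -> T p) /\
   (forall p, on_curve (ellipse8 a b c) p -> inner p -> S p)).
Proof.
  cbv zeta.
  assert (HCS : forall t, cos t ^ 2 + (- sin t)^2 = 1)
    by (intros t; rewrite <- (sin2_cos2 t); unfold Rsqr; ring).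
  assert (EA : forall t, astroida5 a b c t =
    curv_center a b c (a * cos t, 0, c * (- sin t)) (kappa_xz (cos t) (- sin t))).
  { intros t. rewrite curv_center_xz by apply HCS.
    unfold astroida5. apply injective_projections; [apply injective_projections|]; cbn; ring. }
  assert (EE : forall t, ellipse8 a b c t =
    curv_center a b c (a * cos t, 0, c * (- sin t)) (kappa_y (cos t) (- sin t))).
  { intros t. rewrite curv_center_y by apply HCS.
    unfold ellipse8. apply injective_projections; [apply injective_projections|]; cbn; ring. }
  pose proof (fun t => curvature_centers_on_sheets (cos t) (- sin t) (HCS t)) as Sheets.
  cbv zeta in Sheets.
  assert (Hx6A : x6 a b c = sqrt (((a^2 - c^2)/a)^2 * tangency_cos2 ^ 3))
    by (unfold x6, tangency_cos2; f_equal; field; nonzero).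
  assert (Hx6E : x6 a b c = sqrt (((a^2 - b^2)/a)^2 * tangency_cos2 ^ 1))
    by (unfold x6, tangency_cos2; f_equal; field; nonzero).
  split; [right | left]; split; intros q [t [_ <-]] Hq;
    unfold px, astroida5, ellipse8 in Hq; cbn [fst snd] in Hq; rewrite ?EA, ?EE.
  1-2: apply Sheets, (x6_threshold 2 ((a^2 - c^2)/a)); [nonzero | exact Hx6A | exact Hq].
  all: apply Sheets, (x6_threshold 0 ((a^2 - b^2)/a));
    [nonzero | exact Hx6E | rewrite pow_1; exact Hq].
Qed.

Lemma astroida5_ellipse8_position p : pts_xz (x6 a b c) (z6 a b c) p ->
  (1 / a^2 + 1 / c^2 = 3 / b^2 -> on_E a b c p) /\
  (1 / a^2 + 1 / c^2 < 3 / b^2 -> inside_E a b c p) /\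
  (1 / a^2 + 1 / c^2 > 3 / b^2 -> outside_E a b c p).
Proof.
  destruct p as [[x y] z]. intros [Hx [Hy Hz]]. unfold px, py, pz in *; cbn [fst snd] in *.
  unfold x6, z6 in *. subst y.
  rewrite pm_sqrt_iff in Hx, Hz by (positivity; lra).
  destruct (position_of_ellF a b c (x, 0, z) ((b^2)^3/(a^2*c^2)) (1/a^2 + 1/c^2 - 3/b^2))
    as [On [In Out]].
  - positivity; lra.
  - unfold ellF, px, py, pz; cbn [fst snd]. rewrite Hx, Hz. field. nonzero.
  - split; [|split]; intros; [apply On | apply In | apply Out]; lra.
Qed.

Lemma astroida6_ellipse9_position : a^2 + c^2 <= 2*b^2 ->
  forall p, pts_yz (y7 a b c) (z7 a b c) p ->
  (Q6 a b c = 0 -> on_E a b c p) /\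
  (Q6 a b c < 0 -> inside_E a b c p) /\
  (Q6 a b c > 0 -> outside_E a b c p).
Proof.
  intros H [[x y] z] [Hx [Hy Hz]]. unfold px, py, pz in *; cbn [fst snd] in *.
  assert (H2 : 0 < 2*a^2 - b^2 - c^2) by lra.
  unfold y7, z7 in *. subst x.
  replace ((b^2 - a^2)^3 * (2*c^2 - b^2 - a^2)^3 / (b^2 * (c^2 - b^2) * (b^2 + c^2 - 2*a^2)^3))
    with ((a^2 - b^2)^3 * (a^2 + b^2 - 2*c^2)^3 / (b^2 * (b^2 - c^2) * (2*a^2 - b^2 - c^2)^3))
    in Hy by (field; nonzero).
  replace ((c^2 - a^2)^3 * (2*b^2 - c^2 - a^2)^3 / (c^2 * (b^2 - c^2) * (b^2 + c^2 - 2*a^2)^3))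
    with ((a^2 - c^2)^3 * (2*b^2 - a^2 - c^2)^3 / (c^2 * (b^2 - c^2) * (2*a^2 - b^2 - c^2)^3))
    in Hz by (field; nonzero).
  rewrite pm_sqrt_iff in Hy, Hz by (positivity; lra).
  apply position_of_ellF with
    (k := Q6_cofactor (a^2 - b^2) (2*b^2 - a^2 - c^2) (c^2)
          / ((b^2)^2 * (c^2)^2 * (b^2 - c^2) * (2*a^2 - b^2 - c^2)^3)).
  - apply Rdiv_lt_0_compat; [|positivity; lra].
    assert (0 < 9*(a^2 - b^2)^3*(c^2)^3) by (positivity; lra).
    unfold Q6_cofactor. positivity; lra.
  - unfold ellF, px, py, pz; cbn [fst snd]. rewrite Hy, Hz. unfold Q6_cofactor, Q6. field. nonzero.
Qed.

End Ellipsoid.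

Theorem lemma3 (a b c : R) (hab : a > b) (hbc : b > c) (hc : c > 0) :
  (* (1) *)
  (a^2 >= 2*b^2 ->
     intersect_at (ellipse1 a b c) (astroida4 a b c) (pts_xy (x0 a b) (y0 a b))) /\
  (* (2) *)
  (a^2 >= 2*c^2 ->
     intersect_at (ellipse2 a b c) (astroida5 a b c) (pts_xz (x1 a c) (z1 a c))) /\
  (* (3) *)
  (b^2 >= 2*c^2 ->
     intersect_at (ellipse3 a b c) (astroida6 a b c) (pts_yz (y2 b c) (z2 b c))) /\
  (* (4) *)
  ((forall p, ~ (on_curve (ellipse1 a b c) p /\ on_curve (ellipse7 a b c) p)) /\
   (forall x y : C,
      (x * x / RtoC (a^2) + y * y / RtoC (b^2) = 1 /\
       RtoC (a^2) * (x * x) / RtoC ((a^2 - c^2)^2)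
         + RtoC (b^2) * (y * y) / RtoC ((b^2 - c^2)^2) = 1)%C
      <-> (x * x = RtoC (xstar2 a b c) /\ y * y = RtoC (ystar2 a b c))%C) /\
   ystar2 a b c < 0) /\
  (* (5) *)
  (b^2 >= 2*c^2 ->
     intersect_at (ellipse2 a b c) (ellipse8 a b c) (pts_xz (x3 a b c) (z3 a b c)) /\
     x1 a c >= x3 a b c /\ z1 a c <= z3 a b c /\
     (1 / a^2 + 1 / c^2 = 3 / b^2 -> x1 a c = x3 a b c /\ z1 a c = z3 a b c)) /\
  (* (6) *)
  (2*b^2 >= a^2 -> a^2 >= 2*c^2 ->
     intersect_at (ellipse3 a b c) (ellipse9 a b c) (pts_yz (y4 a b c) (z4 a b c)) /\
     (b^2 >= 2*c^2 ->
        (y2 b c >= y4 a b c /\ z2 b c <= z4 a b c <-> Q6 a b c >= 0))) /\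
  (* (7) *)
  (a^2 + c^2 >= 2*b^2 ->
     intersect_at (astroida4 a b c) (ellipse7 a b c) (pts_xy (x5 a b c) (y5 a b c))) /\
  (* (8) *)
  (tangent_curves_at (astroida5 a b c) (ellipse8 a b c) (pts_xz (x6 a b c) (z6 a b c)) /\
   (* the tangency points divide Astroida 5 into parts lying on different sheets *)
   (let S := caustic_sheet1 a b c in let T := caustic_sheet2 a b c in
    let outer p := Rabs (px p) >= x6 a b c in
    let inner p := Rabs (px p) <= x6 a b c in
    ((forall p, on_curve (astroida5 a b c) p -> outer p -> S p) /\
     (forall p, on_curve (astroida5 a b c) p -> inner p -> T p) \/
     (forall p, on_curve (astroida5 a b c) p -> outer p -> T p) /\
     (forall p, on_curve (astroida5 a b c) p -> inner p -> S p)) /\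
    (* and Ellipse 8 into parts lying on different sheets *)
    ((forall p, on_curve (ellipse8 a b c) p -> outer p -> S p) /\
     (forall p, on_curve (ellipse8 a b c) p -> inner p -> T p) \/
     (forall p, on_curve (ellipse8 a b c) p -> outer p -> T p) /\
     (forall p, on_curve (ellipse8 a b c) p -> inner p -> S p))) /\
   (forall p, pts_xz (x6 a b c) (z6 a b c) p ->
      (1 / a^2 + 1 / c^2 = 3 / b^2 -> on_E a b c p) /\
      (1 / a^2 + 1 / c^2 < 3 / b^2 -> inside_E a b c p) /\
      (1 / a^2 + 1 / c^2 > 3 / b^2 -> outside_E a b c p))) /\
  (* (9) *)
  (a^2 + c^2 <= 2*b^2 ->
     intersect_at (astroida6 a b c) (ellipse9 a b c) (pts_yz (y7 a b c) (z7 a b c)) /\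
     (forall p, pts_yz (y7 a b c) (z7 a b c) p ->
        (Q6 a b c = 0 -> on_E a b c p) /\
        (Q6 a b c < 0 -> inside_E a b c p) /\
        (Q6 a b c > 0 -> outside_E a b c p))).
Proof.
  split; [apply ellipse1_astroida4_meet; assumption|].
  split; [apply ellipse2_astroida5_meet; assumption|].
  split; [apply ellipse3_astroida6_meet; assumption|].
  split.
  { split; [apply ellipse1_ellipse7_disjoint; assumption|].
    split; [apply ellipse1_ellipse7_complex_meet; assumption | apply ystar2_neg; assumption]. }
  split; [apply ellipse2_ellipse8_meet; assumption|].
  split; [apply ellipse3_ellipse9_meet; assumption|].
  split; [apply astroida4_ellipse7_meet; assumption|].
  split.
  - split; [split; [apply astroida5_ellipse8_meet | apply astroida5_ellipse8_tangent]; assumption|].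
    split; [apply astroida5_ellipse8_sheets | apply astroida5_ellipse8_position]; assumption.
  - intros H.
    split; [apply astroida6_ellipse9_meet | apply astroida6_ellipse9_position]; assumption.
Qed.
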